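(* Let $S$ be a metric signature, let $L$ be a countable continuous fragment of $\mathcal{L}_{\omega_1,\omega}(S)$, and let $T$ be a satisfiable $L$-theory. For each $n<\omega$ let $\Sigma_n$ be a type of $T$ (in finitely many variables) that is not metrically principal over $T$. Then there is $\mathcal{M}\models T$ such that $\mathcal{M}$ is based on a complete metric space and $\mathcal{M}$ omits each $\Sigma_n$, i.e. no tuple of elements of $\mathcal{M}$ realizes any $\Sigma_n$.
   Context: Metric structures. A metric structure $\mathcal{M}$ consists of a metric space $(M,d)$ with $d\le 1$ (not necessarily complete; $\mathcal M$ is said to be based on $(M,d)$), together with sets of uniformly continuous functions $M^n\to M$, of uniformly continuous predicates $M^n\to[0,1]$, and of distinguished elements; $M^n$ carries the sup metric. A metric signature $S$ consists of function symbols and predicate symbols, each with an arity and a modulus of continuity $\delta:\mathbb{Q}\cap(0,1)\to\mathbb{Q}\cap(0,1)$, and constant symbols. An $S$-structure interprets each symbol respecting its modulus: $\sup_i d(a_i,b_i)<\delta(\epsilon)$ implies $d(f(\bar a),f(\bar b))\le\epsilon$ for function symbols, resp. $|P(\bar a)-P(\bar b)|\le\epsilon$ for predicate symbols. Formulas. Terms are as in first-order logic. Atomic formulas: $d(t_1,t_2)$ and $P(t_1,\dots,t_n)$ for terms $t_i$. Formulas of $\mathcal{L}_{\omega_1,\omega}(S)$ are built from atomic formulas and constants $q\in\mathbb{Q}\cap[0,1]$ by $\varphi\to\psi$, by $\sup_x\varphi$, and by $\sup_{n<\omega}\varphi_n$ when the total number of free variables in all $\varphi_n$ is finite. Truth values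 $\varphi^{\mathcal{M}}(\bar a)\in[0,1]$ are defined by recursion: atomic formulas and constants in the obvious way, $(\psi\to\theta)^{\mathcal M}=\min\{1-\psi^{\mathcal M}+\theta^{\mathcal M},1\}$, and $\sup_{n}$, $\sup_x$ are suprema over $n<\omega$ and over $x\in M$. $\mathcal{M}\models\varphi(\bar a)$ means $\varphi^{\mathcal M}(\bar a)=1$. Abbreviations: $\neg\varphi=(\varphi\to 0)$, with value $1-\varphi$; $\varphi\vee\psi=((\varphi\to\psi)\to\psi)$, the maximum; $\varphi\wedge\psi=\neg(\neg\varphi\vee\neg\psi)$, the minimum. For rational $r$, ''$\varphi\ge r$'' is the formula $r\to\varphi$ and ''$\varphi\le r$'' is the formula $\varphi\to r$. Fragments. A fragment of $\mathcal{L}_{\omega_1,\omega}(S)$ is a set $L$ of $\mathcal{L}_{\omega_1,\omega}(S)$-formulas that contains every atomic formula and every constant formula $q\in\mathbb{Q}\cap[0,1]$, is closed under $\sup_x$, $\to$ and $\neg$, and is closed under substituting terms for variables. It is continuous if for every $L$-formula $\varphi(x_1,\dots,x_n)$ and every $S$-structure $\mathcal{M}$, the function $M^n\to[0,1]$, $\bar a\mapsto\varphi^{\mathcal M}(\bar a)$, is continuous. An $L$-theory is a set of $L$-sentences; it is satisfiable if it has a model (an $S$-structure satisfying all its sentences). Types. A set $\Sigma(x_1,\dots,x_n)$ of $L$-formulas is a type of $T$ if it is realized in some model of $T$: there are $\mathcal{M}\models T$ and $\bar a\in M^n$ with $\mathcal{M}\models\varphi(\bar a)$ for all $\varphi\in\Sigma$.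 A type $\Sigma(x_1,\dots,x_n)$ of $T$ is principal over $T$ if there are an $L$-formula $\varphi(\bar y)$, terms $t_1(\bar y),\dots,t_n(\bar y)$ (with $\bar y$ a finite tuple of variables) and $r\in\mathbb{Q}\cap(0,1)$ such that (i) there are $\mathcal M\models T$ and $\bar b$ in $M$ with $\varphi^{\mathcal M}(\bar b)=1$; and (ii) for all $\mathcal{M}\models T$ and $\bar b$ in $M$ with $\varphi^{\mathcal M}(\bar b)\ge r$, the tuple $(t_1^{\mathcal M}(\bar b),\dots,t_n^{\mathcal M}(\bar b))$ realizes $\Sigma$. For $\delta\in\mathbb{Q}\cap(0,1)$ put $$\Sigma^\delta=\Big\{\sup_{y_1}\cdots\sup_{y_n}\Big(\bigwedge_{k\le n}d(x_k,y_k)\le\delta\ \wedge\ \sigma(y_1,\dots,y_n)\Big):\sigma\in\Sigma\Big\}.$$ A type $\Sigma$ of $T$ is metrically principal over $T$ if for every $\delta\in\mathbb{Q}\cap(0,1)$ the type $\Sigma^\delta$ is principal over $T$.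
   Formalization: A fragment is additionally required to be closed under subformulas (of φ→ψ, sup_x φ and sup_n φ_n); without this standard clause the statement is false. Structures are taken to be nonempty. *)

(* Defs.v *)
From HB Require Import structures.
From mathcomp Require Import all_boot all_order all_algebra.
From mathcomp Require Import all_classical all_reals all_analysis.

Set Implicit Arguments.
Unset Strict Implicit.
Unset Printing Implicit Defensive.

Import Order.TTheory GRing.Theory Num.Theory.
Import numFieldNormedType.Exports.

Local Open Scope classical_set_scope.
Local Open Scope ring_scope.

(* The rationals of the open interval (0,1), resp. of the closed interval
   [0,1]. *)
Definition orat01 := {q : rat | 0 < q < 1}.
Definition crat01 := {q : rat | 0 <= q <= 1}.

Lemma crat01_of_subproof (q : orat01) : 0 <= val q <= 1.
Proof. by case: q => q /= /andP[q0 q1]; rewrite !ltW. Qed.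
Definition crat01_of (q : orat01) : crat01 := exist _ (val q) (crat01_of_subproof q).
Coercion crat01_of : orat01 >-> crat01.

Lemma crat01_zero_subproof : 0 <= (0 : rat) <= 1. Proof. by []. Qed.
Lemma crat01_one_subproof : 0 <= (1 : rat) <= 1. Proof. by []. Qed.
Definition crat01_zero : crat01 := exist _ 0 crat01_zero_subproof.
Definition crat01_one : crat01 := exist _ 1 crat01_one_subproof.

Record signature : Type := Signature {
  func_sym : Type;
  func_arity : func_sym -> nat;
  func_mod : func_sym -> orat01 -> orat01;
  pred_sym : Type;
  pred_arity : pred_sym -> nat;
  pred_mod : pred_sym -> orat01 -> orat01;
  const_sym : Type }.

(* Well-scoped de Bruijn syntax: [term S n] and [formula S n] are the terms
   t(x_1, ..., x_n) and the formulas phi(x_1, ..., x_n), the variable x_(i+1)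
   being [Var i] with [i : 'I_n].  [SupVar] binds the variable of index 0 and
   shifts the other ones.  In [SupNat] all the formulas live in the same finite
   context, so that finitely many variables are free in the whole family. *)
Inductive term (S : signature) (n : nat) : Type :=
| Var of 'I_n
| Const of const_sym S
| App (f : func_sym S) of ('I_(func_arity f) -> term S n).
Arguments Var {S n}.
Arguments Const {S n}.
Arguments App {S n}.

Inductive formula (S : signature) (n : nat) : Type :=
| Dist of term S n & term S n
| Pred (P : pred_sym S) of ('I_(pred_arity P) -> term S n)
| Cte of crat01
| Imp of formula S n & formula S n
| SupVar of formula S n.+1
| SupNat of (nat -> formula S n).
Arguments Pred {S n}.
Arguments Cte {S n}.

Definition scons (A : Type) (n : nat) (a : A) (e : 'I_n -> A) : 'I_n.+1 -> A :=
  fun i => if unlift ord0 i is Some j then e j else a.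

Section Syntax.
Variable S : signature.
Implicit Types n m : nat.

Fixpoint subst_term n m (s : 'I_n -> term S m) (t : term S n) : term S m :=
  match t with
  | Var i => s i
  | Const c => Const c
  | App f ts => App f (fun i => subst_term s (ts i))
  end.

Definition up n m (s : 'I_n -> term S m) : 'I_n.+1 -> term S m.+1 :=
  scons (Var ord0) (fun i => subst_term (fun j => Var (lift ord0 j)) (s i)).

Fixpoint subst n m (s : 'I_n -> term S m) (phi : formula S n) : formula S m :=
  match phi with
  | Dist t u => Dist (subst_term s t) (subst_term s u)
  | Pred P ts => Pred P (fun i => subst_term s (ts i))
  | Cte q => Cte q
  | Imp psi theta => Imp (subst s psi) (subst s theta)
  | SupVar psi => SupVar (subst (up s) psi)
  | SupNat psi => SupNat (fun k => subst s (psi k))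
  end.

Definition f_not n (phi : formula S n) := Imp phi (Cte crat01_zero).
Definition f_or n (phi psi : formula S n) := Imp (Imp phi psi) psi.
Definition f_and n (phi psi : formula S n) := f_not (f_or (f_not phi) (f_not psi)).
Definition f_le n (phi : formula S n) (q : crat01) := Imp phi (Cte q).

Fixpoint sup_vars k n : formula S (k + n) -> formula S n :=
  match k with
  | 0 => fun phi => phi
  | k'.+1 => fun phi => sup_vars (SupVar phi)
  end.

(* In the context n + n, the right summand holds x_1, ..., x_n and the left one
   the n bound variables.  The innermost quantifier binds index 0, hence
   [rev_ord]: the outermost one binds y_1. *)
Definition type_shift n (Sigma : set (formula S n)) (delta : orat01) :
    set (formula S n) :=
  let x (i : 'I_n) : term S (n + n) := Var (rshift n i) in
  let y (i : 'I_n) : term S (n + n) := Var (lshift n (rev_ord i)) in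
  [set sup_vars
         (f_and (\big[@f_and (n + n)/Cte crat01_one]_(i < n)
                   f_le (Dist (x i) (y i)) delta)
               (subst y sigma)) | sigma in Sigma].

End Syntax.

(* As usual in model theory, structures are nonempty. *)
Record structure (R : realType) (S : signature) : Type := Structure {
  carrier :> metricType R;
  carrier_inhabited : inhabited carrier;
  carrier_le1 : forall x y : carrier, mdist x y <= 1;
  func_interp : forall f : func_sym S, ('I_(func_arity f) -> carrier) -> carrier;
  func_interp_mod : forall (f : func_sym S) (eps : orat01)
      (a b : 'I_(func_arity f) -> carrier),
    (forall i, mdist (a i) (b i) < ratr (val (func_mod f eps))) ->
    mdist (func_interp a) (func_interp b) <= ratr (val eps);
  pred_interp : forall P : pred_sym S, ('I_(pred_arity P) -> carrier) -> R;
  pred_interp01 : forall (P : pred_sym S) (a : 'I_(pred_arity P) -> carrier),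
    0 <= pred_interp a <= 1;
  pred_interp_mod : forall (P : pred_sym S) (eps : orat01)
      (a b : 'I_(pred_arity P) -> carrier),
    (forall i, mdist (a i) (b i) < ratr (val (pred_mod P eps))) ->
    `|pred_interp a - pred_interp b| <= ratr (val eps);
  const_interp : const_sym S -> carrier }.
Arguments func_interp {R S} _ _ _.
Arguments pred_interp {R S} _ _ _.
Arguments const_interp {R S} _ _.

Section Semantics.
Variables (R : realType) (S : signature).
Implicit Types (M : structure R S) (n : nat).

Fixpoint term_val M n (t : term S n) (e : 'I_n -> M) : M :=
  match t with
  | Var i => e i
  | Const c => const_interp M c
  | App f ts => func_interp M f (fun i => term_val (ts i) e)
  end.

(* Both suprema are taken over nonempty subsets of [0,1], where [sup] is the
   least upper bound. *)
Fixpoint formula_val M n (phi : formula S n) (e : 'I_n -> M) : R :=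
  match phi with
  | Dist t u => mdist (term_val t e) (term_val u e)
  | Pred P ts => pred_interp M P (fun i => term_val (ts i) e)
  | Cte q => ratr (val q)
  | Imp psi theta => Num.min (1 - formula_val psi e + formula_val theta e) 1
  | SupVar psi => sup [set formula_val psi (scons a e) | a in [set: M]]
  | SupNat psi => sup [set formula_val (psi k) e | k in [set: nat]]
  end.

Definition sat M n (phi : formula S n) (e : 'I_n -> M) : Prop := formula_val phi e = 1.

Definition empty_env M : 'I_0 -> M :=
  fun i => match notF (ltn_ord i) with end.

Definition models M (T : set (formula S 0)) : Prop :=
  forall phi, T phi -> sat phi (empty_env M).

Definition realizes M n (e : 'I_n -> M) (Sigma : set (formula S n)) : Prop :=
  forall sigma, Sigma sigma -> sat sigma e.

Definition is_complete M : Prop :=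
  forall F : set_system M, ProperFilter F -> cauchy F ->
    exists x : M, F --> x.

End Semantics.

(* The last three clauses, closure under subformulas, belong to the usual notion
   of fragment, and omitting types fails without them.  Indeed, over distinct
   constants c_0, c_1, ..., close theta = sup_x inf_k d(x, c_k) under the other
   clauses.  This gives a countable continuous set of formulas.  Let T say that
   d is {0,1}-valued, that the c_k are distinct, and theta.  Every model of T
   realizes {d(x, c_k) | k < omega}; this type is not (metrically) principal,
   because each available formula mentions finitely many c_k outside theta, so
   that the other ones can be moved by an automorphism. *)
Record fragment (S : signature) (L : forall n, set (formula S n)) : Prop := {
  frag_dist : forall n (t u : term S n), L n (Dist t u);
  frag_pred : forall n (P : pred_sym S) (ts : 'I_(pred_arity P) -> term S n),
    L n (Pred P ts);
  frag_cte : forall n q, L n (Cte q);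
  frag_sup : forall n (phi : formula S n.+1), L n.+1 phi -> L n (SupVar phi);
  frag_imp : forall n (phi psi : formula S n),
    L n phi -> L n psi -> L n (Imp phi psi);
  frag_not : forall n (phi : formula S n), L n phi -> L n (f_not phi);
  frag_subst : forall n m (s : 'I_n -> term S m) (phi : formula S n),
    L n phi -> L m (subst s phi);
  frag_sub_imp : forall n (phi psi : formula S n),
    L n (Imp phi psi) -> L n phi /\ L n psi;
  frag_sub_sup : forall n (phi : formula S n.+1),
    L n (SupVar phi) -> L n.+1 phi;
  frag_sub_nat : forall n (phi : nat -> formula S n),
    L n (SupNat phi) -> forall k, L n (phi k) }.

Definition countable_fragment (S : signature)
    (L : forall n, set (formula S n)) : Prop :=
  countable [set p : {n : nat & formula S n} | L (projT1 p) (projT2 p)].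

(* The pseudometric of ['rV[M]_n] is the sup metric of M^n. *)
Definition continuous_fragment (R : realType) (S : signature)
    (L : forall n, set (formula S n)) : Prop :=
  forall n (phi : formula S n), L n phi -> forall M : structure R S,
    continuous (fun a : 'rV[M]_n => formula_val phi (a ord0) : R).

Section Types.
Variables (R : realType) (S : signature) (L : forall n, set (formula S n)).
Variable T : set (formula S 0).

Definition satisfiable : Prop := exists M : structure R S, models M T.

Definition is_type n (Sigma : set (formula S n)) : Prop :=
  Sigma `<=` L (n := n) /\
  exists M : structure R S, models M T /\ exists e : 'I_n -> M, realizes e Sigma.

Definition principal n (Sigma : set (formula S n)) : Prop :=
  exists m (phi : formula S m) (t : 'I_n -> term S m) (r : orat01),
  [/\ L phi,
      exists M : structure R S,
        models M T /\ exists b : 'I_m -> M, formula_val phi b = 1 &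
      forall M : structure R S, models M T -> forall b : 'I_m -> M,
        ratr (val r) <= formula_val phi b -> realizes (fun i => term_val (t i) b) Sigma].

Definition metrically_principal n (Sigma : set (formula S n)) : Prop :=
  forall delta : orat01, principal (type_shift Sigma delta).

End Types.

(* Main.v *)
(** By hypothesis, for each [n] there is [delta n] such that
  [Sigma_n^(delta n)] is not principal.  A Rasiowa-Sikorski argument over the
  conditions "[psi > 0]", with [psi] in [L], produces a sequence of points
  [p_i = (M_i, e_i)], where [M_i] is a model of [T] and [e_i : nat -> M_i],
  that meets all Henkin conditions for [sup_x] and [sup_n] and all conditions
  "some [sigma] in [Sigma_n^(delta n)] stays below some [q < 1] at the terms
  [t]"; the latter are dense because [Sigma_n^(delta n)] is not principal.  In
  the ultraproduct of the [M_i] along a nonprincipal ultrafilter on [nat], let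
  [M] be the closure of the set of the elements given by terms in the variables
  [e_i].  It is complete, and Los's theorem holds for formulas of [L] at tuples
  of terms: for [sup_x], the Henkin conditions bound the limit from above, and
  continuity of the formulas of [L] in [M] reduces the supremum over [M] to one
  over terms.  So [M] is a model of [T].  A realization of [Sigma_n] in [M]
  would make every tuple of terms within distance [delta n] of it realize
  [Sigma_n^(delta n)], which the generic conditions forbid. *)
Require Import Defs.
From HB Require Import structures.
From mathcomp Require Import all_boot all_order all_algebra.
From mathcomp Require Import all_classical all_reals all_analysis.
From mathcomp Require Import lra.

Set Implicit Arguments.
Unset Strict Implicit.
Unset Printing Implicit Defensive.

Import Order.TTheory GRing.Theory Num.Theory.
Import numFieldNormedType.Exports.

Local Open Scope classical_set_scope.
Local Open Scope ring_scope.

(** * Limits of sequences in [0,1] along an ultrafilter *)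

Section UltraLimit.
Variables (R : realType) (U : set_system nat).
Hypothesis UU : UltraFilter U.
Implicit Types f g : nat -> R.

Let PU : ProperFilter U := ultra_proper.

Definition unital f := forall i, 0 <= f i <= 1.

Definition ulim f : R := lim (f @ U).

(** Compactness of [0,1] gives the image filter a cluster point, and an image of an ultrafilter
    converges to each of its cluster points. *)
Lemma ulim_cvg f : unital f -> f @ U --> ulim f.
Proof.
move=> f01; apply/cvg_ex.
have f_itv : (f @ U) `[0, 1]%classic.
  by apply: (@filterE _ U) => i; rewrite /= in_itv /=; exact: f01.
have [l [_ cl]] := @segment_compact R 0 1 (f @ U) _ f_itv.
exists l => A Al.
have [//|nA] := in_ultra_setVsetC (f @^-1` A) UU.
by have [x [nAx /nAx]] := cl (~` A) A nA Al.
Qed.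

Lemma ulim_unique f l : f @ U --> l -> ulim f = l.
Proof. exact: cvg_lim. Qed.

Lemma ulim_cst c : ulim (fun=> c) = c.
Proof. by apply: ulim_unique; exact: cvg_cst. Qed.

Lemma ulim_le_near f g : unital f -> unital g ->
  (\forall i \near U, f i <= g i) -> ulim f <= ulim g.
Proof. by move=> /ulim_cvg fl /ulim_cvg gl; exact: ler_cvg_to fl gl. Qed.

Lemma ulim_le_cst f c : unital f -> (\forall i \near U, f i <= c) -> ulim f <= c.
Proof. by move=> /ulim_cvg fl; apply: limr_le; apply/cvg_ex; exists (ulim f). Qed.

Lemma ulim_ge_cst f c : unital f -> (\forall i \near U, c <= f i) -> c <= ulim f.
Proof. by move=> /ulim_cvg fl; apply: limr_ge; apply/cvg_ex; exists (ulim f). Qed.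

Lemma ulim_lt f c : unital f -> ulim f < c -> \forall i \near U, f i < c.
Proof. by move=> /ulim_cvg fl fc; apply: (cvgr_lt (ulim f)). Qed.

Lemma ulim01 f : unital f -> 0 <= ulim f <= 1.
Proof.
move=> f01; apply/andP; split.
  by apply: ulim_ge_cst => //; apply: filterE => i; case/andP: (f01 i).
by apply: ulim_le_cst => //; apply: filterE => i; case/andP: (f01 i).
Qed.

Lemma ulim_triangle f g h : unital f -> unital g -> unital h ->
  (forall i, f i <= g i + h i) -> ulim f <= ulim g + ulim h.
Proof.
move=> /ulim_cvg fl /ulim_cvg gl /ulim_cvg hl fgh.
have ghl : (fun i => g i + h i) @ U --> ulim g + ulim h by exact: cvgD.
by apply: (ler_cvg_to fl ghl); apply: filterE.
Qed.

Lemma ulim_le_addr f g c : unital f -> unital g ->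
  (\forall i \near U, f i <= g i + c) -> ulim f <= ulim g + c.
Proof.
move=> /ulim_cvg fl /ulim_cvg gl fgc.
have gcl : (fun i => g i + c) @ U --> ulim g + c by apply: cvgD => //; exact: cvg_cst.
exact: (ler_cvg_to fl gcl).
Qed.

Lemma ulim_imp f g : unital f -> unital g ->
  ulim (fun i => Num.min (1 - f i + g i) 1) = Num.min (1 - ulim f + ulim g) 1.
Proof.
move=> /ulim_cvg fl /ulim_cvg gl; apply: ulim_unique.
have h : (fun i => 1 - f i + g i) @ U --> 1 - ulim f + ulim g.
  by apply: cvgD => //; apply: cvgB => //; exact: cvg_cst.
pose k (x : R) := Num.min x 1.
have kc : continuous k.
  move=> x; apply: continuous_min; [exact: cvg_id|exact: cvg_cst].
exact: (cvg_comp _ _ h (kc _)).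
Qed.

End UltraLimit.

(** * Truth values: bounds, connectives, substitution and shifted types *)

Section FormulaValues.
Variables (R : realType) (S : signature).
Implicit Types (M : structure R S) (n : nat).

Lemma mdist01 M (x y : M) : 0 <= mdist x y <= 1.
Proof. by rewrite mdist_ge0 carrier_le1. Qed.

Lemma orat01P (q : orat01) : 0 < (ratr (val q) : R) < 1.
Proof.
by case: q => q /= /andP[q0 q1]; rewrite ltr0q q0 -(rmorph1 (@ratr R)) ltr_rat.
Qed.

Lemma orat01_between (x y : R) : 0 <= x -> x < y -> y <= 1 ->
  exists q : orat01, x < ratr (val q) < y.
Proof.
move=> x0 /rat_in_itvoo[q]; rewrite in_itv /= => /andP[xq qy] y1.
have q01 : 0 < q < 1.
  rewrite -(ltr0q R) (le_lt_trans x0 xq) /=.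
  by rewrite -(ltr_rat R) rmorph1 (lt_le_trans qy).
by exists (exist _ q q01); rewrite xq.
Qed.

Lemma orat01_between2 (x y : R) : 0 <= x -> x < y -> y <= 1 ->
  exists q q' : orat01, [/\ x < ratr (val q), val q < val q' & ratr (val q') < y].
Proof.
move=> x0 xy y1; have [q /andP[xq qy]] := orat01_between x0 xy y1.
have [q' /andP[qq' q'y]] := orat01_between (le_trans x0 (ltW xq)) qy y1.
by exists q, q'; split => //; rewrite -(ltr_rat R).
Qed.

Lemma orat01_lt (e : R) : 0 < e -> exists q : orat01, ratr (val q) < e.
Proof.
move=> e0; have [||q /andP[_]] := @orat01_between 0 (Num.min e 1) (lexx _).
- by rewrite lt_min e0 ltr01.
- by rewrite ge_min lexx orbT.
- by rewrite lt_min => /andP[qe _]; exists q.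
Qed.

Lemma imp01 (x y : R) : 0 <= x <= 1 -> 0 <= y <= 1 ->
  0 <= Num.min (1 - x + y) 1 <= 1.
Proof.
move=> /andP[x0 x1] /andP[y0 y1].
by rewrite le_min ler01 ge_min lexx orbT !andbT addr_ge0 // subr_ge0.
Qed.

Lemma sup01 (A : set R) : A !=set0 -> (forall x, A x -> 0 <= x <= 1) ->
  0 <= sup A <= 1.
Proof.
move=> [x Ax] A01; apply/andP; split.
  case/andP: (A01 x Ax) => x0 _; apply: (le_trans x0).
  by apply: ub_le_sup => //; exists 1 => y /A01/andP[].
by apply: ge_sup; [exists x|move=> y /A01/andP[]].
Qed.

Lemma formula_val01 M n (phi : formula S n) (e : 'I_n -> M) :
  0 <= formula_val phi e <= 1.
Proof.
elim: phi e => {n} [n t u|n P ts|n [q q01]|n f IHf g IHg|n f IHf|n f IHf] e /=.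
- exact: mdist01.
- exact: pred_interp01.
- by case/andP: q01 => q0 q1; rewrite ler0q q0 -(rmorph1 (@ratr R)) ler_rat.
- exact: imp01.
- apply: sup01 => [|_ [a _ <-]//].
  by have [a] := carrier_inhabited M; exists (formula_val f (scons a e)), a.
- by apply: sup01 => [|_ [k _ <-]//]; exists (formula_val (f 0) e), 0.
Qed.

Lemma le_val_SupVar M n (phi : formula S n.+1) (e : 'I_n -> M) a :
  formula_val phi (scons a e) <= formula_val (SupVar phi) e.
Proof.
apply: ub_le_sup; last by exists a.
by exists 1 => _ [b _ <-]; case/andP: (formula_val01 phi (scons b e)).
Qed.

Lemma le_val_SupNat M n (phi : nat -> formula S n) (e : 'I_n -> M) k :
  formula_val (phi k) e <= formula_val (SupNat phi) e.
Proof.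
apply: ub_le_sup; last by exists k.
by exists 1 => _ [j _ <-]; case/andP: (formula_val01 (phi j) e).
Qed.

Lemma val_SupVar_le M n (phi : formula S n.+1) (e : 'I_n -> M) (c : R) :
  (forall a, formula_val phi (scons a e) <= c) -> formula_val (SupVar phi) e <= c.
Proof.
move=> le_c; apply: ge_sup => [|_ [a _ <-]//].
by have [a] := carrier_inhabited M; exists (formula_val phi (scons a e)), a.
Qed.

Lemma val_SupNat_le M n (phi : nat -> formula S n) (e : 'I_n -> M) (c : R) :
  (forall k, formula_val (phi k) e <= c) -> formula_val (SupNat phi) e <= c.
Proof.
move=> le_c; apply: ge_sup => [|_ [k _ <-]//].
by exists (formula_val (phi 0) e), 0.
Qed.

Lemma lt_val_SupVar M n (phi : formula S n.+1) (e : 'I_n -> M) (c : R) :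
  c < formula_val (SupVar phi) e -> exists a, c < formula_val phi (scons a e).
Proof.
move=> c_lt; apply: contrapT => /forallNP ge_c.
suff: formula_val (SupVar phi) e <= c by rewrite leNgt c_lt.
by apply: val_SupVar_le => a; rewrite leNgt; apply/negP/ge_c.
Qed.

Lemma lt_val_SupNat M n (phi : nat -> formula S n) (e : 'I_n -> M) (c : R) :
  c < formula_val (SupNat phi) e -> exists k, c < formula_val (phi k) e.
Proof.
move=> c_lt; apply: contrapT => /forallNP ge_c.
suff: formula_val (SupNat phi) e <= c by rewrite leNgt c_lt.
by apply: val_SupNat_le => k; rewrite leNgt; apply/negP/ge_c.
Qed.

Lemma val_f_not M n (phi : formula S n) (e : 'I_n -> M) :
  formula_val (f_not phi) e = 1 - formula_val phi e.
Proof.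
rewrite /= rmorph0 addr0; apply/min_idPl.
by rewrite gerBl; case/andP: (formula_val01 phi e).
Qed.

Lemma val_f_and M n (phi psi : formula S n) (e : 'I_n -> M) :
  formula_val (f_and phi psi) e = Num.min (formula_val phi e) (formula_val psi e).
Proof.
rewrite val_f_not /f_or [formula_val _ _]/= -!/(formula_val (f_not _) e).
rewrite -[Num.min (1 - formula_val phi e + _) 1]/(formula_val (f_not phi) e).
rewrite -[Num.min (1 - formula_val psi e + _) 1]/(formula_val (f_not psi) e).
rewrite !val_f_not.
have /andP[+ _] := formula_val01 phi e; have /andP[+ _] := formula_val01 psi e.
move: (formula_val phi e) (formula_val psi e) => x y y0 x0.
(* The order of [x] and [y] decides every truncation at 1: the inner implication from [1 - x] to
   [1 - y] is cut down to 1 when [y < x]. *)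
have [xy|yx] := leP x y.
  have -> : Num.min (1 - (1 - x) + (1 - y)) 1 = 1 - (1 - x) + (1 - y).
    by apply/min_idPl; lra.
  have -> : Num.min (1 - (1 - (1 - x) + (1 - y)) + (1 - y)) 1
    = 1 - (1 - (1 - x) + (1 - y)) + (1 - y) by apply/min_idPl; lra.
  lra.
have -> : Num.min (1 - (1 - x) + (1 - y)) 1 = 1 by apply/min_idPr; lra.
have -> : Num.min (1 - 1 + (1 - y)) 1 = 1 - 1 + (1 - y) by apply/min_idPl; lra.
lra.
Qed.

Lemma eq_scons (A B : Type) n (f : A -> B) a (e : 'I_n -> A) :
  (fun i => f (scons a e i)) = scons (f a) (fun i => f (e i)).
Proof. by apply/funext => i; rewrite /scons; case: unlift. Qed.

Lemma scons_lift (A : Type) n (a : A) (e : 'I_n -> A) i :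
  scons a e (lift ord0 i) = e i.
Proof. by rewrite /scons liftK. Qed.

Lemma scons0 (A : Type) n (a : A) (e : 'I_n -> A) : scons a e ord0 = a.
Proof. by rewrite /scons unlift_none. Qed.

Lemma term_val_subst M n m (s : 'I_n -> term S m) (t : term S n) (e : 'I_m -> M) :
  term_val (subst_term s t) e = term_val t (fun i => term_val (s i) e).
Proof.
elim: t => //= f ts IH; congr (func_interp M f _).
by apply/funext => i; exact: IH.
Qed.

Lemma term_val_up M n m (s : 'I_n -> term S m) (e : 'I_m -> M) a :
  (fun i => term_val (up s i) (scons a e)) = scons a (fun i => term_val (s i) e).
Proof.
rewrite /up (eq_scons (fun t => term_val t (scons a e))) /= scons0.
congr scons; apply/funext => i; rewrite term_val_subst; congr term_val.
by apply/funext => j /=; rewrite scons_lift.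
Qed.

Lemma formula_val_subst M n m (s : 'I_n -> term S m) (phi : formula S n)
    (e : 'I_m -> M) :
  formula_val (subst s phi) e = formula_val phi (fun i => term_val (s i) e).
Proof.
elim: phi m s e => {n} [n t u|n P ts|n q|n f IHf g IHg|n f IHf|n f IHf] m s e //=.
- by rewrite !term_val_subst.
- by congr (pred_interp M P _); apply/funext => i; rewrite term_val_subst.
- by rewrite IHf IHg.
- congr (sup _); congr image; apply/funext => a; rewrite IHf.
  by rewrite term_val_up.
- by congr (sup _); congr image; apply/funext => k; rewrite IHf.
Qed.

Lemma scons_ord0_lift (A : Type) n (e : 'I_n.+1 -> A) :
  scons (e ord0) (fun i => e (lift ord0 i)) = e.
Proof. by apply/funext => i; rewrite /scons; case: unliftP => [j|] ->. Qed.

(** Each entry of [e] at an index below [k] serves as the witness for one quantifier of the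
    prefix. *)
Lemma le_val_sup_vars M k n (phi : formula S (k + n)) (e : 'I_(k + n) -> M) :
  formula_val phi e <= formula_val (sup_vars phi) (fun i => e (rshift k i)).
Proof.
elim: k phi e => [|k IH] phi e /=.
  rewrite (_ : (fun i => e (rshift 0 i)) = e) //.
  by apply/funext => i; congr e; apply/val_inj.
rewrite -{1}(scons_ord0_lift e).
apply: le_trans (le_val_SupVar phi (fun i => e (lift ord0 i)) (e ord0)) _.
apply: le_trans (IH (SupVar phi) (fun i => e (lift ord0 i))) _.
rewrite (_ : (fun i => e (lift ord0 (rshift k i))) = fun i => e (rshift k.+1 i)) //.
by apply/funext => i; congr e; apply/val_inj.
Qed.

(** The tuple [x] itself witnesses the quantifiers. The names are thus swapped with respect to
    [type_shift]: here [y] interprets the free variables and [x] the bound ones. *)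
Lemma val_type_shift M n (Sg : set (formula S n)) (delta : orat01) (x y : 'I_n -> M) :
  realizes x Sg -> (forall j, mdist (y j) (x j) <= ratr (val delta)) ->
  realizes y (type_shift Sg delta).
Proof.
move=> xSg yx _ [sg Sgsg <-].
(* The bound variables are listed in reverse order, hence [rev_ord]. *)
pose e (i : 'I_(n + n)) :=
  match fintype.split i with inl j => x (rev_ord j) | inr j => y j end.
have eL j : e (lshift n j) = x (rev_ord j).
  by rewrite /e -[lshift n j]/(unsplit (inl j)) unsplitK.
have eR j : e (rshift n j) = y j by rewrite /e -[rshift n j]/(unsplit (inr j)) unsplitK.
rewrite /sat.
set phi := f_and _ _; have phi1 : formula_val phi e = 1.
  rewrite val_f_and formula_val_subst (_ : (fun i => term_val _ e) = x); last first.
    by apply/funext => j /=; rewrite eL rev_ordK.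
  rewrite (xSg _ Sgsg) -[RHS]minxx; congr Num.min.
  apply: (big_ind (fun psi : formula S (n + n) => formula_val psi e = 1)).
  - by rewrite /= rmorph1.
  - by move=> f g f1 g1; rewrite val_f_and f1 g1 minxx.
  - move=> i _ /=; rewrite eL eR rev_ordK; apply/min_idPr.
    by have := yx i; lra.
have -> : y = fun i => e (rshift n i) by apply/funext.
apply/le_anti/andP; split.
  by case/andP: (formula_val01 (sup_vars phi) (fun i => e (rshift n i))).
by rewrite -phi1; exact: le_val_sup_vars.
Qed.

Section FragmentClosure.
Variable L : forall n, set (formula S n).
Hypothesis fragL : fragment L.

Lemma frag_and n (phi psi : formula S n) : L phi -> L psi -> L (f_and phi psi).
Proof.
move=> Lphi Lpsi; have Ln := frag_not fragL; have Li := frag_imp fragL.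
by apply/Ln/Li; [apply: Li; exact: Ln|exact: Ln].
Qed.

Lemma frag_sup_vars k n (phi : formula S (k + n)) : L phi -> L (sup_vars phi).
Proof. by elim: k phi => //= k IH phi Lphi; apply: IH; exact: frag_sup. Qed.

Lemma frag_type_shift n (Sg : set (formula S n)) delta :
  Sg `<=` L (n := n) -> type_shift Sg delta `<=` L (n := n).
Proof.
move=> SgL _ [sg /SgL Lsg <-]; apply/frag_sup_vars/frag_and; last exact: frag_subst.
apply: big_ind => [|f g|i _]; [exact: frag_cte|exact: frag_and|].
by apply: frag_imp => //; [exact: frag_dist|exact: frag_cte].
Qed.

End FragmentClosure.

(** Tuples replace the row vectors of [continuous_fragment], whose balls are taken entrywise. *)
Lemma formula_val_cont (L : forall n, set (formula S n)) :
  continuous_fragment R L -> forall n (phi : formula S n), L n phi ->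
  forall M (a : 'I_n -> M) (e : R), 0 < e -> exists2 d : R, 0 < d &
    forall b, (forall j, mdist (a j) (b j) < d) ->
      `|formula_val phi a - formula_val phi b| < e.
Proof.
move=> contL n phi Lphi M a e e0.
have rowE (c : 'I_n -> M) : (\row_j c j) ord0 = c by apply/funext => j; rewrite mxE.
have /cvg_ballP/(_ e e0)/nbhs_ballP[d d0 ad] := contL n phi Lphi M (\row_j a j).
exists d => // b abd; have := ad (\row_j b j); rewrite /= !rowE; apply.
by split => // i j; rewrite !mxE ballEmdist; exact: abd.
Qed.

End FormulaValues.

(** * The closure of [D] in the ultraproduct as a metric space *)

Section UltraClosure.
Variables (R : realType) (S : signature) (Ms : nat -> structure R S).
Variables (U : set_system nat) (UU : UltraFilter U).
Variable D : set (forall i, Ms i).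
Hypothesis D_const : forall c, D (fun i => const_interp (Ms i) c).
Hypothesis D_func : forall f (a : 'I_(func_arity f) -> forall i, Ms i),
  (forall j, D (a j)) -> D (fun i => func_interp (Ms i) f (fun j => a j i)).

Let PU : ProperFilter U := ultra_proper.

(* [uquot] below is the closure of [D] in the ultraproduct of the [Ms i]. *)
Definition uclosure : set (forall i, Ms i) :=
  [set x | forall e : R, 0 < e ->
    exists2 y, D y & \forall i \near U, mdist (x i) (y i) < e].

Definition uelt := {x | uclosure x}.

HB.instance Definition _ := gen_eqMixin uelt.
HB.instance Definition _ := gen_choiceMixin uelt.

Definition udist (x y : uelt) : R := ulim U (fun i => mdist (sval x i) (sval y i)).

Lemma unital_dist (x y : forall i, Ms i) : unital (fun i => mdist (x i) (y i) : R).
Proof. by move=> i; exact: mdist01. Qed.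
Hint Resolve unital_dist : core.

Lemma udistxx x : udist x x = 0.
Proof.
rewrite /udist (_ : (fun _ => _) = fun=> 0) ?ulim_cst //.
by apply/funext => i; rewrite mdistxx.
Qed.

Lemma udist_sym x y : udist x y = udist y x.
Proof. by congr ulim; apply/funext => i; exact: metric_sym. Qed.

Lemma udist_ge0 x y : 0 <= udist x y.
Proof. by case/andP: (ulim01 UU (unital_dist (sval x) (sval y))). Qed.

Lemma udist_triangle y x z : udist x z <= udist x y + udist y z.
Proof. by apply: ulim_triangle => // i; exact: metric_triangle. Qed.

Definition usim : rel uelt := fun x y => udist x y == 0.

Lemma usim_refl : reflexive usim.
Proof. by move=> x; rewrite /usim udistxx. Qed.

Lemma usim_sym : symmetric usim.
Proof. by move=> x y; rewrite /usim udist_sym. Qed.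

Lemma usim_trans : transitive usim.
Proof.
move=> y x z /eqP xy /eqP yz; apply/eqP/le_anti; rewrite udist_ge0 andbT.
by apply: (le_trans (udist_triangle y x z)); rewrite xy yz addr0.
Qed.

Canonical usim_equiv := EquivRel usim usim_refl usim_sym usim_trans.

Definition uquot : Type := {eq_quot usim_equiv}%qT.
HB.instance Definition _ := Choice.on uquot.

Definition ucls (x : uelt) : uquot := (\pi_({eq_quot usim_equiv}%qT) x)%qT.
Definition urep (x : uquot) : uelt := repr (x : {eq_quot usim_equiv}%qT).

Lemma urepK x : ucls (urep x) = x.
Proof. exact: reprK. Qed.

Lemma uclsP x y : ucls x = ucls y <-> udist x y = 0.
Proof.
split=> [/(@eqmodP _ usim_equiv)/eqP//|xy].
by apply/(@eqmodP _ usim_equiv)/eqP.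
Qed.

Lemma udist_urep x : udist (urep (ucls x)) x = 0.
Proof. by apply/uclsP; rewrite urepK. Qed.

Definition qdist (x y : uquot) : R := udist (urep x) (urep y).

(** The chosen representative of [ucls x] may differ from [x], but lies at distance 0 from it; the
    triangle inequality does the rest. *)
Lemma qdist_ucls x y : qdist (ucls x) (ucls y) = udist x y.
Proof.
have xx := udist_urep x; have yy := udist_urep y; rewrite /qdist.
apply/le_anti/andP; split.
  apply: (le_trans (udist_triangle x _ _)); rewrite xx add0r.
  by apply: (le_trans (udist_triangle y _ _)); rewrite (udist_sym y (urep _)) yy addr0.
apply: (le_trans (udist_triangle (urep (ucls x)) _ _)); rewrite (udist_sym x) xx add0r.
by apply: (le_trans (udist_triangle (urep (ucls y)) _ _)); rewrite yy addr0.
Qed.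

Lemma qdistxx x : qdist x x = 0.
Proof. exact: udistxx. Qed.

Lemma qdist_eq0 x y : qdist x y = 0 -> x = y.
Proof. by move/uclsP; rewrite !urepK. Qed.

Lemma qdist_sym x y : qdist x y = qdist y x.
Proof. exact: udist_sym. Qed.

Lemma qdist_triangle y x z : qdist x z <= qdist x y + qdist y z.
Proof. exact: udist_triangle. Qed.

HB.instance Definition _ :=
  isMetric.Build R uquot qdistxx qdist_eq0 qdist_sym qdist_triangle.

Lemma uquot_mdist (x y : uquot) : mdist x y = qdist x y.
Proof. by []. Qed.

(** * Interpretation of the symbols in the quotient *)

Lemma uconst_subproof c : uclosure (fun i => const_interp (Ms i) c).
Proof.
move=> e e0; exists (fun i => const_interp (Ms i) c); first exact: D_const.
by apply: filterE => i; rewrite mdistxx.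
Qed.
Definition uconst c : uelt := exist _ _ (uconst_subproof c).

(** Each argument is approximated from [D] within the modulus of [f]. The arity is finite, so all
    the approximations are good at once on a set of [U]. *)
Lemma ufunc_subproof f (a : 'I_(func_arity f) -> uelt) :
  uclosure (fun i => func_interp (Ms i) f (fun j => sval (a j) i)).
Proof.
move=> e /orat01_lt[q qe].
have /andP[d0 _] := orat01P R (func_mod f q).
have /choice[b b_near] : forall j, exists y, D y /\
    \forall i \near U, mdist (sval (a j) i) (y i) < ratr (val (func_mod f q)).
  by move=> j; case: (proj2_sig (a j) _ d0) => y; exists y.
have /all_and2[Db ab] := b_near.
exists (fun i => func_interp (Ms i) f (fun j => b j i)); first exact: D_func.
apply: filterS (filter_forall _ ab) => i abi.
exact: le_lt_trans (func_interp_mod abi) qe.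
Qed.
Definition ufunc f (a : 'I_(func_arity f) -> uelt) : uelt :=
  exist _ _ (ufunc_subproof a).

Lemma near_udist_lt n (a b : 'I_n -> uelt) (c : R) :
  (forall j, udist (a j) (b j) < c) ->
  \forall i \near U, forall j, mdist (sval (a j) i) (sval (b j) i) < c.
Proof. by move=> abc; apply: filter_forall => j; apply: ulim_lt (abc j). Qed.

Lemma ufunc_mod f (q : orat01) (a b : 'I_(func_arity f) -> uelt) :
  (forall j, udist (a j) (b j) < ratr (val (func_mod f q))) ->
  udist (ufunc a) (ufunc b) <= ratr (val q).
Proof.
move=> /near_udist_lt ab; apply: ulim_le_cst => //.
by apply: filterS ab => i; exact: func_interp_mod.
Qed.

Definition upred P (a : 'I_(pred_arity P) -> uelt) : R :=
  ulim U (fun i => pred_interp (Ms i) P (fun j => sval (a j) i)).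

Lemma unital_pred P (a : 'I_(pred_arity P) -> forall i, Ms i) :
  unital (fun i => pred_interp (Ms i) P (fun j => a j i)).
Proof. by move=> i; exact: pred_interp01. Qed.

Lemma upred_mod P (q : orat01) (a b : 'I_(pred_arity P) -> uelt) :
  (forall j, udist (a j) (b j) < ratr (val (pred_mod P q))) ->
  `|upred a - upred b| <= ratr (val q).
Proof.
move=> /near_udist_lt ab.
have {}ab : \forall i \near U,
  `|pred_interp (Ms i) P (fun j => sval (a j) i) -
    pred_interp (Ms i) P (fun j => sval (b j) i)| <= ratr (val q).
  by apply: filterS ab => i; exact: pred_interp_mod.
rewrite ler_norml; apply/andP; split.
  rewrite lerBrDl lerBlDr; apply: ulim_le_addr; [exact: unital_pred..|].
  by apply: filterS ab => i; rewrite ler_norml => /andP[+ _]; lra.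
rewrite lerBlDl; apply: ulim_le_addr; [exact: unital_pred..|].
by apply: filterS ab => i; rewrite ler_norml => /andP[_]; lra.
Qed.

(** Distance 0 is below every value of the modulus, so the images are within every positive
    rational. Hence the choice of representatives in [qfunc] is harmless. *)
Lemma ufunc_ucls f (a b : 'I_(func_arity f) -> uelt) :
  (forall j, udist (a j) (b j) = 0) -> ucls (ufunc a) = ucls (ufunc b).
Proof.
move=> ab; apply/uclsP/le_anti; rewrite udist_ge0 andbT.
rewrite leNgt; apply/negP => /orat01_lt[q]; rewrite ltNge => /negP; apply.
by apply: ufunc_mod => j; rewrite ab; case/andP: (orat01P R (func_mod f q)).
Qed.

Lemma upred_eq P (a b : 'I_(pred_arity P) -> uelt) :
  (forall j, udist (a j) (b j) = 0) -> upred a = upred b.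
Proof.
move=> ab; apply/eqP; rewrite -subr_eq0 -normr_le0.
rewrite leNgt; apply/negP => /orat01_lt[q]; rewrite ltNge => /negP; apply.
by apply: upred_mod => j; rewrite ab; case/andP: (orat01P R (pred_mod P q)).
Qed.

Definition qfunc f (a : 'I_(func_arity f) -> uquot) : uquot :=
  ucls (ufunc (fun j => urep (a j))).
Definition qpred P (a : 'I_(pred_arity P) -> uquot) : R :=
  upred (fun j => urep (a j)).

Lemma qfunc_mod f (q : orat01) (a b : 'I_(func_arity f) -> uquot) :
  (forall j, mdist (a j) (b j) < ratr (val (func_mod f q))) ->
  mdist (qfunc a) (qfunc b) <= ratr (val q).
Proof. by move=> ab; rewrite uquot_mdist qdist_ucls; exact: ufunc_mod. Qed.

Lemma qpred01 P (a : 'I_(pred_arity P) -> uquot) : 0 <= qpred a <= 1.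
Proof. by apply: ulim01; exact: unital_pred. Qed.

Lemma qpred_mod P (q : orat01) (a b : 'I_(pred_arity P) -> uquot) :
  (forall j, mdist (a j) (b j) < ratr (val (pred_mod P q))) ->
  `|qpred a - qpred b| <= ratr (val q).
Proof. exact: upred_mod. Qed.

Lemma uquot_le1 (x y : uquot) : mdist x y <= 1.
Proof. by case/andP: (ulim01 UU (unital_dist (sval (urep x)) (sval (urep y)))). Qed.

Hypothesis D_neq0 : D !=set0.

Lemma D_uclosure : D `<=` uclosure.
Proof. by move=> x Dx e e0; exists x => //; apply: filterE => i; rewrite mdistxx. Qed.

Lemma uquot_inhabited : inhabited uquot.
Proof.
by case: D_neq0 => x /D_uclosure Dx; apply: inhabits; exact: ucls (exist _ x Dx).
Qed.

Definition ustructure : structure R S :=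
  @Structure R S uquot uquot_inhabited uquot_le1 qfunc qfunc_mod qpred
    qpred01 qpred_mod (fun c => ucls (uconst c)).

Lemma uelt_dense (x : uelt) (e : R) : 0 < e ->
  exists2 y : uelt, D (sval y) & udist x y < e.
Proof.
move=> e0; have [|y Dy xy] := proj2_sig x (e / 2); first by rewrite divr_gt0.
exists (exist _ y (D_uclosure Dy)) => //.
apply: (@le_lt_trans _ _ (e / 2)); last by lra.
by apply: ulim_le_cst => //; apply: filterS xy => i /ltW.
Qed.

(* Let [s] be a sequence with [s k'] and [s k] closer than
   [2 * eps k'] for [k' <= k].  The diagonal [y i := s (K i) i] is its limit when
   [K i] is the largest [k <= i] for which these bounds hold at coordinate [i]. *)
Lemma ustructure_complete : \oo `<=` U -> is_complete ustructure.
Proof.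
move=> ooU F PF /cauchyP Fc.
pose eps k : R := k.+1%:R^-1.
have eps0 k : 0 < eps k by rewrite invr_gt0.
have eps_le k k' : (k' <= k)%N -> eps k <= eps k'.
  by move=> kk; rewrite lef_pV2 ?posrE // ler_nat.
have eps_lt e : 0 < e -> exists k, eps k < e.
  by move=> e0; exact: filter_ex (near_infty_natSinv_lt (PosNum e0)).
have /choice[x Fx] k : exists x : ustructure, F (ball x (eps k)) by exact: Fc.
pose s k : uelt := urep (x k : uquot).
have s_near k k' : (k' <= k)%N ->
    \forall i \near U, mdist (sval (s k') i) (sval (s k) i) < 2 * eps k'.
  move=> kk; apply: ulim_lt => //.
  (* Both balls belong to the proper filter [F], so they meet. *)
  have [z [zk zk']] := filter_ex (filterI (Fx k) (Fx k')).
  have {}zk : qdist (x k) z < eps k by move: zk; rewrite ballEmdist.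
  have {}zk' : qdist (x k') z < eps k' by move: zk'; rewrite ballEmdist.
  have tri : udist (s k') (s k) <= qdist (x k') z + qdist (x k) z.
    by rewrite (qdist_sym (x k)); exact: qdist_triangle.
  by apply: le_lt_trans tri _; have := eps_le _ _ kk; lra.
pose good i k := (k <= i)%N /\ forall k', (k' <= k)%N ->
  mdist (sval (s k') i) (sval (s k) i) < 2 * eps k'.
have /choice[K maxK] i : exists K, good i K /\ forall k, good i k -> (k <= K)%N.
  have good0 : exists k, `[< good i k >].
    exists 0; apply/asboolP; split => // k'; rewrite leqn0 => /eqP ->.
    by rewrite mdistxx mulr_gt0.
  have good_le k : `[< good i k >] -> (k <= i)%N by move=> /asboolP[].
  case: (ex_maxnP good0 good_le) => K /asboolP goodK Kmax.
  by exists K; split => // k goodk; apply: Kmax; apply/asboolP.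
pose y i := sval (s (K i)) i.
(* Since [U] contains the cofinite sets, [k <= i] holds near [U]. Then [k] is good at [i], so
   [k <= K i], and the goodness of [K i] bounds the distance to [s k]. *)
have sy k : \forall i \near U, mdist (sval (s k) i) (y i) < 2 * eps k.
  have ki : \forall i \near U, (k <= i)%N by apply: ooU; exact: nbhs_infty_ge.
  have sk : \forall i \near U, forall k' : 'I_k.+1,
      mdist (sval (s k') i) (sval (s k) i) < 2 * eps k'.
    by apply: filter_forall => k'; apply: s_near; rewrite -ltnS.
  apply: filterS (filterI ki sk) => i [{}ki {}sk].
  have [[_ goodK] Kmax] := maxK i.
  apply: goodK; apply: Kmax; split => // k' kk.
  exact: (sk (Ordinal (kk : k' < k.+1)%N)).
(* [y] is within [2 * eps k < e / 2] of [s k], which is within [e / 2] of an element of [D]. *)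
have cy : uclosure y.
  move=> e e0; have [|k ke] := eps_lt (e / 4); first by rewrite divr_gt0.
  have [|z Dz sz] := proj2_sig (s k) (e / 2); first by rewrite divr_gt0.
  exists z => //; apply: filterS (filterI (sy k) sz) => i [syi szi].
  apply: le_lt_trans (metric_triangle _ (sval (s k) i) _) _.
  by rewrite metric_sym; lra.
exists (ucls (exist _ y cy)); apply/fcvg_ballP => e e0.
(* The distances [2 * eps k] to [x k] and [eps k] from there to [z] must add up to less than [e]. *)
have [|k ke] := eps_lt (e / 3); first by rewrite divr_gt0.
apply: filterS (Fx k) => z xz.
have {}xz : qdist (x k) z < eps k by move: xz; rewrite ballEmdist.
rewrite ballEmdist /=.
apply: le_lt_trans (qdist_triangle (x k) _ _) _.
have : qdist (ucls (exist _ y cy)) (x k) <= 2 * eps k.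
  rewrite -[X in qdist _ X]urepK qdist_ucls udist_sym.
  by apply: ulim_le_cst => //; apply: filterS (sy k) => i /ltW.
lra.
Qed.

(** * Los's theorem at tuples from [D] *)

Fixpoint uterm n (t : term S n) (a : 'I_n -> uelt) : uelt :=
  match t with
  | Var i => a i
  | Const c => uconst c
  | App f ts => ufunc (fun j => uterm (ts j) a)
  end.

Definition ueval n (a : 'I_n -> uelt) i : 'I_n -> Ms i := fun j => sval (a j) i.

Lemma sval_uterm n (t : term S n) (a : 'I_n -> uelt) i :
  sval (uterm t a) i = term_val t (ueval a i).
Proof.
elim: t => //= f ts IH; congr (func_interp _ _ _).
by apply/funext => j; exact: IH.
Qed.

(** [uterm] computes on sequences, before classes are taken; [ufunc_ucls] makes the two evaluations
    agree. *)
Lemma term_val_ucls n (t : term S n) (a : 'I_n -> uelt) :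
  term_val (M := ustructure) t (fun j => ucls (a j)) = ucls (uterm t a).
Proof.
elim: t => //= f ts IH; apply: ufunc_ucls => j.
by rewrite IH udist_urep.
Qed.

Lemma ueval_scons n (a : 'I_n -> uelt) (b : uelt) i :
  ueval (scons b a) i = scons (sval b i) (ueval a i).
Proof. exact: (eq_scons (fun x : uelt => sval x i)). Qed.

Lemma unital_val n (phi : formula S n) (a : 'I_n -> uelt) :
  unital (fun i => formula_val phi (ueval a i)).
Proof. by move=> i; exact: formula_val01. Qed.

Variable L : forall n, set (formula S n).
Hypothesis fragL : fragment L.
Hypothesis contL : continuous_fragment R L.
(** The Henkin property in approximate form. It is stated for a pair [q < q'] because the overlap of
    the two alternatives is what lets generic conditions decide between them. *)
Hypothesis D_witness : forall n (phi : formula S n.+1), L (SupVar phi) ->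
  forall a : 'I_n -> uelt, (forall j, D (sval (a j))) ->
  forall q q' : orat01, val q < val q' ->
  (\forall i \near U, formula_val (SupVar phi) (ueval a i) <= ratr (val q')) \/
  exists2 b : uelt, D (sval b) &
    \forall i \near U, ratr (val q) < formula_val phi (scons (sval b i) (ueval a i)).
Hypothesis D_index : forall n (phi : nat -> formula S n), L (SupNat phi) ->
  forall a : 'I_n -> uelt, (forall j, D (sval (a j))) ->
  forall q q' : orat01, val q < val q' ->
  (\forall i \near U, formula_val (SupNat phi) (ueval a i) <= ratr (val q')) \/
  exists k, \forall i \near U, ratr (val q) < formula_val (phi k) (ueval a i).

(** The parameters stay in [D], where witnesses and indices are available; arbitrary elements of the
    closure enter only as values of a bound variable. *)
Lemma los n (phi : formula S n) (a : 'I_n -> uelt) :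
  L phi -> (forall j, D (sval (a j))) ->
  formula_val (M := ustructure) phi (fun j => ucls (a j)) =
    ulim U (fun i => formula_val phi (ueval a i)).
Proof.
elim: phi a => {n} [n t u|n P ts|n q|n f IHf g IHg|n f IHf|n f IHf] a Lphi Da.
- rewrite /= !term_val_ucls [LHS]qdist_ucls; congr ulim; apply/funext => i.
  by rewrite !sval_uterm.
- rewrite /= -[LHS]/(upred (fun j => urep (term_val (M := ustructure) (ts j) _))).
  under eq_fun => j do rewrite term_val_ucls.
  rewrite (@upred_eq _ _ (fun j => uterm (ts j) a)) => [|j]; last exact: udist_urep.
  congr ulim; apply/funext => i; congr (pred_interp _ _ _).
  by apply/funext => j; rewrite sval_uterm.
- by rewrite /= ulim_cst.
- have [Lf Lg] := frag_sub_imp fragL Lphi.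
  by rewrite /= IHf // IHg // -ulim_imp //; exact: unital_val.
- have Lf := frag_sub_sup fragL Lphi.
  have IH b : D (sval b) ->
      formula_val (M := ustructure) f (scons (ucls b) (fun j => ucls (a j))) =
      ulim U (fun i => formula_val f (ueval (scons b a) i)).
    move=> Db; rewrite -(eq_scons ucls) IHf // => j.
    by rewrite /scons; case: unlift.
  apply/le_anti/andP; split.
    (* If the value at [x] exceeded the limit [y], then by continuity so would the value at some [b]
       from [D] near [x], against [le_y]. *)
    apply: val_SupVar_le => x; rewrite leNgt; apply/negP => lt_x.
    set y := ulim _ _ in lt_x.
    have [d d0 cont_x] := @formula_val_cont R S L contL _ f Lf ustructure
      (scons x (fun j => ucls (a j))) _ (etrans (subr_gt0 _ _) lt_x).
    have [b Db xb] := uelt_dense (urep x) d0.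
    have le_y :
        formula_val (M := ustructure) f (scons (ucls b) (fun j => ucls (a j))) <= y.
      rewrite IH //; apply: ulim_le_near; [exact: unital_val..|].
      by apply: filterE => i; rewrite ueval_scons; exact: le_val_SupVar.
    have : `|formula_val (M := ustructure) f (scons x (fun j => ucls (a j))) -
        formula_val (M := ustructure) f (scons (ucls b) (fun j => ucls (a j)))|
        < formula_val (M := ustructure) f (scons x (fun j => ucls (a j))) - y.
      apply: cont_x => j; rewrite /scons; case: unlift => [k|].
        by rewrite mdistxx.
      by rewrite -[x]urepK [mdist _ _]qdist_ucls.
    by rewrite ltr_norml => /andP[_]; lra.
  have /andP[N0 _] := formula_val01 (SupVar f) (fun j => ucls (a j) : ustructure).
  have /andP[_ y1] := ulim01 UU (unital_val (SupVar f) a).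
  (* Two rationals are put strictly between the value in [ustructure] and the limit: the first
     alternative contradicts [q'_lt], the second [lt_q]. *)
  rewrite leNgt; apply/negP => lt_y.
  have [q [q' [lt_q qq' q'_lt]]] := orat01_between2 N0 lt_y y1.
  have [le_q'|[b Db lt_b]] := D_witness Lphi Da qq'.
    move: q'_lt; rewrite ltNge => /negP; apply.
    by apply: ulim_le_cst => //; exact: unital_val.
  move: lt_q; rewrite ltNge => /negP; apply.
  have := le_val_SupVar f (fun j => ucls (a j) : ustructure) (ucls b).
  rewrite IH //; apply: le_trans; apply: ulim_ge_cst; first exact: unital_val.
  by apply: filterS lt_b => i; rewrite ueval_scons => /ltW.
- have Lf := frag_sub_nat fragL Lphi.
  apply/le_anti/andP; split.
    apply: val_SupNat_le => k; rewrite IHf //.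
    apply: ulim_le_near; [exact: unital_val..|].
    by apply: filterE => i; exact: le_val_SupNat.
  have /andP[N0 _] := formula_val01 (SupNat f) (fun j => ucls (a j) : ustructure).
  have /andP[_ y1] := ulim01 UU (unital_val (SupNat f) a).
  rewrite leNgt; apply/negP => lt_y.
  have [q [q' [lt_q qq' q'_lt]]] := orat01_between2 N0 lt_y y1.
  have [le_q'|[k lt_k]] := D_index Lphi Da qq'.
    move: q'_lt; rewrite ltNge => /negP; apply.
    by apply: ulim_le_cst => //; exact: unital_val.
  move: lt_q; rewrite ltNge => /negP; apply.
  have := le_val_SupNat f (fun j => ucls (a j) : ustructure) k.
  rewrite IHf //; apply: le_trans; apply: ulim_ge_cst; first exact: unital_val.
  by apply: filterS lt_k => i /ltW.
Qed.

End UltraClosure.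

(** * Generic sequences of models with assignments *)

Section Generic.
Variables (R : realType) (S : signature) (L : forall n, set (formula S n)).
Hypothesis fragL : fragment L.
Variable T : set (formula S 0).

(** The assignment covers all of [nat], so that formulas in different contexts are read at the same
    point and fresh variables are always at hand. *)
Record point := Point {
  pt_str : structure R S;
  pt_model : models pt_str T;
  pt_val : nat -> pt_str }.

Definition pt_env (p : point) n : 'I_n -> pt_str p := fun i => pt_val p i.
Arguments pt_env p n : clear implicits.

(* Subclasses of [point] are predicates and not [set]s: the universe of
   structures is too large for [set]. *)
Definition basic (A : point -> Prop) := exists m (psi : formula S m),
  L psi /\ forall p, A p <-> 0 < formula_val psi (pt_env p m).

Definition nonempty_basic A := basic A /\ exists p, A p.

Definition dense_in_basic (D : (point -> Prop) -> Prop) :=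
  forall A, nonempty_basic A ->
  exists B, [/\ nonempty_basic B, forall p, B p -> A p & D B].

Definition widen_var n m (nm : (n <= m)%N) : 'I_n -> term S m :=
  fun i => Var (widen_ord nm i).

Lemma val_widen n m (nm : (n <= m)%N) (phi : formula S n) p :
  formula_val (subst (widen_var nm) phi) (pt_env p m) = formula_val phi (pt_env p n).
Proof. by rewrite formula_val_subst. Qed.

Lemma basicT : basic (fun=> True).
Proof.
exists 0, (Cte crat01_one); split; first exact: frag_cte.
by move=> p; rewrite /= rmorph1.
Qed.

Lemma basicI A B : basic A -> basic B -> basic (fun p => A p /\ B p).
Proof.
move=> [m [phi [Lphi AE]]] [n [psi [Lpsi BE]]].
exists (maxn m n), (f_and (subst (widen_var (leq_maxl m n)) phi)
                          (subst (widen_var (leq_maxr m n)) psi)); split.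
  by apply: frag_and => //; exact: frag_subst.
move=> p; rewrite val_f_and lt_min !val_widen AE BE.
by split=> /andP.
Qed.

(* [~ (phi <= q)] has value [max (phi - q) 0]. *)
Lemma basic_gt n (phi : formula S n) (q : orat01) : L phi ->
  basic (fun p => ratr (val q) < formula_val phi (pt_env p n)).
Proof.
move=> Lphi; exists n, (f_not (f_le phi q)); split.
  by apply: frag_not => //; apply: frag_imp => //; exact: frag_cte.
move=> p; rewrite val_f_not subr_gt0 /= gt_min ltxx orbF; split; lra.
Qed.

Lemma basic_lt n (phi : formula S n) (q : orat01) : L phi ->
  basic (fun p => formula_val phi (pt_env p n) < ratr (val q)).
Proof.
move=> Lphi; exists n, (f_not (Imp (Cte q) phi)); split.
  by apply: frag_not => //; apply: frag_imp => //; exact: frag_cte.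
move=> p; rewrite val_f_not subr_gt0 /= gt_min ltxx orbF; split; lra.
Qed.

(** Requirements are met one by one, in the order of an injective code, along a decreasing sequence
    of nonempty basic classes [A n]; [p n] is any point of [A n]. The [A n] may have no common
    point: the ultraproduct uses only that [p] is eventually in each of them. *)
Lemma generic_sequence (I : Type) (X : set I) (Q : I -> (point -> Prop) -> Prop) :
  countable X -> (forall x, X x -> dense_in_basic (Q x)) -> (exists p : point, True) ->
  exists p : nat -> point, forall x, X x ->
    exists2 B, Q x B & \forall i \near \oo, B (p i).
Proof.
move=> /countable_injP[code code_inj] Qdense [p0 _].
have /choice[step stepP] (y : nat * (point -> Prop)) : exists B : point -> Prop,
    nonempty_basic y.2 -> [/\ nonempty_basic B, forall p, B p -> y.2 p &
      forall x, X x -> code x = y.1 -> Q x B].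
  case: y => n A /=.
  have [[x [Xx xn]]|nox] := pselect (exists x, X x /\ code x = n); last first.
    (* A number that codes no requirement leaves the class unchanged. *)
    by exists A => bA; split => // x Xx xn; case: nox; exists x.
  have [bA|nbA] := pselect (nonempty_basic A); last by exists A => bA; case: nbA.
  have [B [bB BA QB]] := Qdense x Xx A bA.
  exists B => _; split => // x' Xx' x'n.
  by rewrite (code_inj x' x) ?inE // xn.
pose A := fix A n := if n is n'.+1 then step (n', A n') else (fun=> True).
have bA n : nonempty_basic (A n).
  elim: n => [|n bA]; first by split; [exact: basicT|exists p0].
  by have [] := stepP (n, A n) bA.
have A_decr n m p : (n <= m)%N -> A m p -> A n p.
  move=> /subnKC <-; elim: (m - n)%N => [|d IH]; first by rewrite addn0.
  rewrite addnS => Ap; apply: IH.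
  by have [_ sub _] := stepP ((n + d)%N, A (n + d)%N) (bA _); apply: sub.
have /choice[p Ap] n : exists p, A n p by have [] := bA n.
(* The requirement of code [n] is met in passing from [A n] to [A n.+1], hence the successor. *)
exists p => x Xx; exists (A (code x).+1).
  by have [_ _ QA] := stepP (code x, A (code x)) (bA _); exact: QA.
by exists (code x).+1 => // i /= /A_decr; apply.
Qed.

(** * Density of the Henkin and omitting conditions *)

Definition henkin n (phi : formula S n) (q q' : orat01) (B : point -> Prop) : Prop :=
  match phi with
  | SupVar f =>
      (forall p, B p -> formula_val (SupVar f) (pt_env p n) <= ratr (val q')) \/
      exists j, forall p, B p ->
        ratr (val q) < formula_val f (scons (pt_val p j) (pt_env p n))
  | SupNat f =>
      (forall p, B p -> formula_val (SupNat f) (pt_env p n) <= ratr (val q')) \/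
      exists k, forall p, B p -> ratr (val q) < formula_val (f k) (pt_env p n)
  | _ => True
  end.

(** At a point [p] of [A] either the supremum is below [q'], which is a basic condition, or it is at
    least [q'], hence above [q], and some witness or index already exceeds [q]. *)
Lemma henkin_dense n (phi : formula S n) (q q' : orat01) :
  L phi -> val q < val q' -> dense_in_basic (henkin phi q q').
Proof.
move=> Lphi qq' A [bA [p Ap]].
have {}qq' : ratr (val q) < ratr (val q') :> R by rewrite ltr_rat.
case: phi Lphi => [? ?|? ?|?|? ?|f|f] Lphi;
  try by exists A; split => //; split => //; exists p.
- have [lt_q'|ge_q'] := ltP (formula_val (SupVar f) (pt_env p n)) (ratr (val q')).
    exists (fun p => A p /\ formula_val (SupVar f) (pt_env p n) < ratr (val q')).
    split; [split|by move=> ? []|by left => ? [_ /ltW]]; last by exists p.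
    by apply: basicI => //; exact: basic_lt.
  have [a lt_a] := lt_val_SupVar (lt_le_trans qq' ge_q').
  have [m [psi [Lpsi AE]]] := bA.
  (* The variable [j] is fresh: [psi] and [SupVar f] only see indices below [m] and [n]. The
     substitution [s] puts it in place of the bound variable. *)
  pose j := maxn m n.
  pose s : 'I_n.+1 -> term S j.+1 :=
    scons (Var ord_max) (widen_var (leqW (leq_maxr m n))).
  have sE r : formula_val (subst s f) (pt_env r j.+1) =
      formula_val f (scons (pt_val r j) (pt_env r n)).
    by rewrite formula_val_subst (eq_scons (fun t => term_val t (pt_env r j.+1))).
  exists (fun r => A r /\ ratr (val q) < formula_val (subst s f) (pt_env r j.+1)).
  split; [split|by move=> ? []|by right; exists j => r [_]; rewrite sE].
    apply: basicI => //; apply: basic_gt; apply: frag_subst => //.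
    exact: (frag_sub_sup fragL).
  (* Only the value at [j] changes, so [r] remains in [A]. *)
  pose r := Point (pt_model p) (fun i => if i == j then a else pt_val p i).
  have envE l : (l <= j)%N -> pt_env r l = pt_env p l.
    move=> lj; apply/funext => i; rewrite /pt_env /=.
    by rewrite ltn_eqF // (leq_trans (ltn_ord i)).
  exists r; split; first by move: Ap; rewrite !AE envE // leq_maxl.
  by rewrite sE envE ?leq_maxr //= eqxx.
- have [lt_q'|ge_q'] := ltP (formula_val (SupNat f) (pt_env p n)) (ratr (val q')).
    exists (fun p => A p /\ formula_val (SupNat f) (pt_env p n) < ratr (val q')).
    split; [split|by move=> ? []|by left => ? [_ /ltW]]; last by exists p.
    by apply: basicI => //; exact: basic_lt.
  have [k lt_k] := lt_val_SupNat (lt_le_trans qq' ge_q').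
  exists (fun r => A r /\ ratr (val q) < formula_val (f k) (pt_env r n)).
  split; [split|by move=> ? []|by right; exists k => ? []]; last by exists p.
  by apply: basicI => //; apply: basic_gt; exact: (frag_sub_nat fragL).
Qed.

(** A single bound [q < 1] for all points of [B], unlike a mere strict inequality at each point,
    survives the ultralimit. *)
Definition omit n (Sg : set (formula S n)) m (t : 'I_n -> term S m)
    (B : point -> Prop) : Prop :=
  exists2 sg, Sg sg & exists q : orat01, forall p, B p ->
    formula_val sg (fun j => term_val (t j) (pt_env p m)) <= ratr (val q).

(** Otherwise the terms [u], the formula [q -> psi] and the threshold [r] would show that [Sg] is
    principal, where [psi] defines [A] in a context shared with [t]. *)
Lemma omit_dense n (Sg : set (formula S n)) m (t : 'I_n -> term S m) :
  Sg `<=` L (n := n) -> ~ principal R L T Sg -> dense_in_basic (omit Sg t).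
Proof.
move=> SgL nprincipal A [bA [p Ap]]; have [l [psi0 [Lpsi0 AE]]] := bA.
pose k := maxn l m.
pose psi := subst (widen_var (leq_maxl l m)) psi0.
pose u j := subst_term (widen_var (leq_maxr l m)) (t j).
have Lpsi : L psi by exact: frag_subst.
have psiE r : formula_val psi (pt_env r k) = formula_val psi0 (pt_env r l).
  exact: val_widen.
have uE r j : term_val (u j) (pt_env r k) = term_val (t j) (pt_env r m).
  by rewrite term_val_subst.
have /andP[psi_ge0 psi_le1] := formula_val01 psi (pt_env p k).
have psi_gt0 : 0 < formula_val psi (pt_env p k) by rewrite psiE -AE.
have [q /andP[q0 q_lt]] := orat01_between (lexx 0) psi_gt0 psi_le1.
have /andP[_ q1] := orat01P R q.
(* As [q] is below [psi] at [p], the formula [q -> psi] has value 1 there; as [r > 1 - q], any value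
   of it that is at least [r] forces [psi > 0], that is, membership in [A]. *)
have [||r /andP[r_gt r1]] := @orat01_between R (1 - ratr (val q)) 1 _ _ (lexx 1).
- by lra.
- by lra.
have [M [MT [b rb [sg Sgsg ne1]]]] : exists M : structure R S, models M T /\
    exists2 b : 'I_k -> M, ratr (val r) <= formula_val (Imp (Cte q) psi) b &
    exists2 sg, Sg sg & formula_val sg (fun j => term_val (u j) b) <> 1.
  apply: contrapT => no_b; apply: nprincipal.
  exists k, (Imp (Cte q) psi), u, r; split.
  - by apply: frag_imp => //; exact: frag_cte.
  - exists (pt_str p); split; first exact: pt_model.
    by exists (pt_env p k) => /=; apply/min_idPr; lra.
  - move=> M MT b rb sg Sgsg; apply: contrapT => ne1; apply: no_b.
    by exists M; split => //; exists b => //; exists sg.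
have [x0] := carrier_inhabited M.
(* The tuple [b] is extended to all of [nat] by the filler [x0]. *)
pose r' := Point MT (fun i => if insub i is Some j then b j else x0).
have r'E : pt_env r' k = b.
  by apply/funext => i; rewrite /pt_env /= valK.
have /andP[sg0 sg1] := formula_val01 sg (fun j => term_val (u j) b).
have sg_lt1 : formula_val sg (fun j => term_val (u j) b) < 1.
  by rewrite lt_neqAle sg1 andbT; apply/eqP.
have [s /andP[s_gt s1]] := orat01_between sg0 sg_lt1 (lexx 1).
exists (fun r => A r /\ formula_val (subst u sg) (pt_env r k) < ratr (val s)).
split; [split|by move=> ? []|].
- apply: basicI => //.
  by apply: basic_lt; apply: frag_subst => //; exact: SgL.
- exists r'; split => /=; last by rewrite r'E formula_val_subst.
  rewrite AE -psiE r'E.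
  by move: rb; rewrite /= le_min => /andP[+ _]; lra.
- exists sg => //; exists s => v [_] /=; rewrite formula_val_subst => /ltW.
  by under eq_fun => j do rewrite uE.
Qed.

End Generic.
Arguments pt_env {R S T} p n _.

(** * Countability of the set of requirements *)

Section Requirements.
Variables (S : signature) (L : forall n, set (formula S n)) (k : nat -> nat).

Definition requirement : Type :=
  ({n & formula S n} * (orat01 * orat01)) + {n & {m & 'I_(k n) -> term S m}}.

Definition valid_requirement : set requirement :=
  [set x | if x is inl (phi, (q, q')) then L (projT2 phi) /\ val q < val q' else True].

(** A term [t] is coded by the formula [Dist t t], which belongs to every fragment; so the
    countability of [L] also bounds the finite tuples of terms. *)
Lemma countable_requirement : fragment L -> countable_fragment L ->
  countable valid_requirement.
Proof.
move=> fragL /countable_injP[code code_inj]; apply/countable_injP.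
pose tcode m (t : term S m) := code (existT _ m (Dist t t)).
pose encode (x : requirement) : nat * (rat * rat) + nat * nat * seq nat :=
  match x with
  | inl (phi, (q, q')) => inl (code phi, (val q, val q'))
  | inr (existT n (existT m t)) => inr (n, m, [seq tcode m (t j) | j <- enum 'I_(k n)])
  end.
have tcode_inj m : injective (@tcode m).
  move=> t u /code_inj tu.
  have /(@existT_inj2 nat (formula S))[] // :
    existT (formula S) m (Dist t t) = existT _ m (Dist u u).
  by apply: tu; rewrite inE; exact: frag_dist.
exists (pickle \o encode) => x y; rewrite !inE => vx vy /(pcan_inj pickleK).
case: x vx => [[phi [q q']] [Lphi _]|[n [m t]] _];
    case: y vy => [[psi [r r']] [Lpsi _]|[n2 [m2 u]] _] //=.
  move=> [/code_inj phipsi /val_inj -> /val_inj ->].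
  by rewrite phipsi // inE.
move=> [nn mm]; case: n2 / nn u => u; case: m2 / mm u => u /eq_in_map tu.
suff -> : t = u by [].
by apply/funext => j; apply/tcode_inj/tu; rewrite mem_enum.
Qed.

End Requirements.

Theorem theorem4p14 (R : realType) (S : signature)
    (L : forall n : nat, set (formula S n))
    (fragL : fragment L) (countL : countable_fragment L)
    (contL : continuous_fragment R L)
    (T : set (formula S 0)) (TL : T `<=` L 0%N) (satT : satisfiable R T)
    (k : nat -> nat) (Sigma : forall n : nat, set (formula S (k n)))
    (typeSigma : forall n : nat, is_type R L T (Sigma n))
    (nonprincipal : forall n : nat, ~ metrically_principal R L T (Sigma n)) :
  exists M : structure R S,
    [/\ models M T,
        is_complete M &
        forall (n : nat) (a : 'I_(k n) -> M), ~ realizes a (Sigma n)].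
Proof.
have [delta nprincipal] : {delta : nat -> orat01 | forall n,
    ~ principal R L T (type_shift (Sigma n) (delta n))}.
  have /choice[delta] n : exists delta, ~ principal R L T (type_shift (Sigma n) delta).
    exact/existsNP/nonprincipal.
  by exists delta.
have SigmaL n : type_shift (Sigma n) (delta n) `<=` L (k n).
  by apply: frag_type_shift => //; case: (typeSigma n).
pose Q (x : requirement S k) : (point R T -> Prop) -> Prop :=
  match x with
  | inl (phi, (q, q')) => henkin (projT2 phi) q q'
  | inr t => omit (type_shift (Sigma (projT1 t)) (delta (projT1 t))) (projT2 (projT2 t))
  end.
have [||p pQ] := @generic_sequence _ _ _ fragL _ _ _ Q
    (countable_requirement k fragL countL).
- case=> [[phi [q q']] [Lphi qq']|[n [m t]] _]; first exact: henkin_dense.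
  by apply: omit_dense.
- by have [M MT] := satT; have [x] := carrier_inhabited M; exists (Point MT (fun=> x)).
have [U [UU ooU]] := ultraFilterLemma (eventually_filter : ProperFilter \oo).
have PU := @ultra_proper _ _ UU.
pose Ms i := pt_str (p i).
pose D : set (forall i, Ms i) := [set x | exists m (t : term S m),
  forall i, x i = term_val t (pt_env (p i) m)].
(* The terms naming a finite tuple are moved to the largest of their contexts, so that parameters
   from [D] amount to a substitution [s]. *)
have joint n (a : 'I_n -> forall i, Ms i) : (forall j, D (a j)) ->
    exists m (s : 'I_n -> term S m), forall i,
      (fun j => a j i) = fun j => term_val (s j) (pt_env (p i) m).
  move=> Da; have /choice[u uP] j : exists u : {m & term S m}, forall i,
      a j i = term_val (projT2 u) (pt_env (p i) (projT1 u)).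
    by have [m [t at_]] := Da j; exists (existT _ m t).
  exists (\max_j projT1 (u j)).
  exists (fun j => subst_term (widen_var S (leq_bigmax j)) (projT2 (u j))) => i.
  by apply/funext => j; rewrite uP term_val_subst.
have Dvar j : D (fun i => pt_val (p i) j).
  by exists j.+1, (Var ord_max).
have Dconst c : D (fun i => const_interp (Ms i) c) by exists 0, (Const c).
have Dfunc f (a : 'I_(func_arity f) -> forall i, Ms i) : (forall j, D (a j)) ->
    D (fun i => func_interp (Ms i) f (fun j => a j i)).
  move=> /joint[m [s sP]]; exists m, (App f s) => i /=.
  by rewrite sP.
have D0 : D !=set0 by exists (fun i => pt_val (p i) 0).
have uevalE n (a : 'I_n -> uelt U D) : (forall j, D (sval (a j))) ->
    exists m (s : 'I_n -> term S m), forall i,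
      ueval a i = fun j => term_val (s j) (pt_env (p i) m).
  exact: joint.
pose M := ustructure UU Dconst Dfunc D0.
have losM := @los _ _ _ _ UU _ Dconst Dfunc D0 L fragL contL.
have {}losM : forall n (phi : formula S n) (a : 'I_n -> uelt U D),
    L n phi -> (forall j, D (sval (a j))) ->
    formula_val (M := M) phi (fun j => ucls UU (a j)) =
    ulim U (fun i => formula_val phi (ueval a i)).
  apply: losM => n phi Lphi a /uevalE[m [s sP]] q q' qq'.
  (* The generic conditions speak of variables only; parameters given by terms are absorbed by
     substitution, under which [L] is closed. *)
  - have [B] := pQ (inl (existT _ m (subst s (SupVar phi)), (q, q')))
      (conj (frag_subst fragL s Lphi) qq').
    case=> [B_le|[j B_gt]] /ooU UB; [left|right].
      apply: filterS UB => i /B_le; apply: le_trans.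
      by rewrite sP -formula_val_subst.
    exists (exist _ _ (D_uclosure UU (Dvar j))); first exact: Dvar.
    apply: filterS UB => i /B_gt/lt_le_trans; apply.
    by rewrite sP -term_val_up -formula_val_subst.
  - have [B] := pQ (inl (existT _ m (subst s (SupNat phi)), (q, q')))
      (conj (frag_subst fragL s Lphi) qq').
    case=> [B_le|[j B_gt]] /ooU UB; [left|right].
      apply: filterS UB => i /B_le; apply: le_trans.
      by rewrite sP -formula_val_subst.
    exists j; apply: filterS UB => i /B_gt/lt_le_trans; apply.
    by rewrite sP -formula_val_subst.
exists M; split.
- move=> phi Tphi; rewrite /sat.
  pose a (j : 'I_0) : uelt U D := match notF (ltn_ord j) with end.
  rewrite (_ : empty_env M = fun j => ucls UU (a j)); last by apply/funext => -[].
  rewrite losM; [|exact: TL|by case].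
  rewrite (_ : (fun i => _) = fun=> 1) ?ulim_cst //; apply/funext => i.
  rewrite -[RHS](pt_model (p i) Tphi); congr formula_val.
  by apply/funext => -[].
- exact: ustructure_complete.
- move=> n x xSigma.
  have /andP[delta0 _] := orat01P R (delta n).
  (* A supposed realization [x] is approximated within [delta n] by a tuple [y] from [D], to which
     both the omitting condition and Los's theorem apply. *)
  have /choice[y] (j : 'I_(k n)) : exists y : uelt U D,
      D (sval y) /\ udist (urep (x j : uquot UU D)) y < ratr (val (delta n)).
    by have [y Dy xy] := uelt_dense UU (urep (x j : uquot UU D)) delta0; exists y.
  move=> /all_and2[Dy xy].
  have [m [s sP]] := uevalE _ _ Dy.
  have [B [sg Sgsg [q B_le]] /ooU UB] := pQ (inr (existT _ n (existT _ m s))) I.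
  have : realizes (fun j => ucls UU (y j) : M) (type_shift (Sigma n) (delta n)).
    apply: val_type_shift xSigma _ => j; apply/ltW.
    by rewrite metric_sym -[x j]urepK [mdist _ _]qdist_ucls.
  move=> /(_ sg Sgsg); rewrite /sat losM //; last exact: SigmaL.
  (* By Los's theorem the value of [sg] at [y] is a limit of values that are at most [q < 1] near
     [U], so it cannot be 1. *)
  apply/eqP; rewrite lt_eqF //.
  have /andP[_ q1] := orat01P R q; apply: le_lt_trans q1.
  apply: ulim_le_cst; first exact: unital_val.
  by apply: filterS UB => i /B_le; rewrite sP.
Qed.
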